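(* Consider the spherical mixed spin glass with mixture function $\xi$. Suppose that $\xi$ admits a discontinuous RSB transition and that $\beta_c<\beta_{\mathrm{cont}}$. Then there exists $q\in(0,1)$ with $\beta_c^2\,\xi'(q)>\frac{q}{1-q}$.
   Context: Setting (spherical). Let $\xi(x)=\sum_{k\ge2}\gamma_k^2x^k$ with $\gamma_k$ real, $\xi(1)=1$ and $\xi(1+\alpha)<\infty$ for some $\alpha>0$. Let $\Sigma_N=\{\sigma\in\mathbb R^N:\|\sigma\|=\sqrt N\}$, $\mu_0$ the uniform probability measure on $\Sigma_N$, and $$H_N(\sigma)=\sum_{k\ge2}\frac{\gamma_k}{N^{(k-1)/2}}\sum_{1\le i_1,\dots,i_k\le N}g_{i_1,\dots,i_k}\sigma_{i_1}\cdots\sigma_{i_k}$$ with $g_{i_1,\dots,i_k}$ i.i.d. $N(0,1)$. Let $F(\beta)=\lim_{N\to\infty}\frac1N\mathbb E\log\int e^{\beta H_N(\sigma)}d\mu_0(\sigma)$. $\beta_c=\sup\{\beta\ge0:F(\beta)=\beta^2/2\}$; on the sphere it is known that $\beta_c^2=\inf_{q\in(0,1)}\frac{-\log(1-q)-q}{\xi(q)}$. Also $\beta_{\mathrm{cont}}=\xi''(0)^{-1/2}$ (equal to $+\infty$ if $\xi''(0)=0$). Parisi measure. $\zeta_\beta$ denotes the unique minimizer (with minimum value $F(\beta)$), over probability measures $\zeta$ with $\hat q=\inf\{s:\zeta([0,s])=1\}<1$, of $$\frac12\Big(\int_0^1\beta^2\xi'(t)\zeta([0,t])\,dt+\int_0^{\hat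 q}\frac{dt}{\phi_\zeta(t)}+\log(1-\hat q)\Big),\qquad \phi_\zeta(t)=\int_t^1\zeta([0,s])\,ds.$$ With $q_{\max}(\zeta)=\sup\,\mathrm{supp}(\zeta)$, $\xi$ admits a discontinuous RSB transition if $\lim_{\beta\downarrow\beta_c}q_{\max}(\zeta_\beta)>0$. *)

(* Defs.v *)
From HB Require Import structures.
From mathcomp Require Import all_boot all_order all_algebra.
From mathcomp Require Import all_classical all_reals all_analysis.

Set Implicit Arguments.
Unset Strict Implicit.
Unset Printing Implicit Defensive.

Import Order.TTheory GRing.Theory Num.Theory.
Import numFieldNormedType.Exports.

Local Open Scope classical_set_scope.
Local Open Scope ring_scope.

Section Mixture.
Context {R : realType} (gamma : nat -> R).

(* A limit of partial sums: meaningful where the series converges. *)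
Definition xi (x : R) : R :=
  limn (fun n => \sum_(2 <= k < n) gamma k ^+ 2 * x ^+ k).

Definition mixture_finite_at (x : R) : Prop :=
  cvgn (fun n => \sum_(2 <= k < n) gamma k ^+ 2 * x ^+ k).

Definition mixture_hyp : Prop :=
  xi 1 = 1 /\ exists2 alpha : R, 0 < alpha & mixture_finite_at (1 + alpha).

Definition beta_cont : \bar R :=
  if derive1n 2 xi 0 == 0 then +oo%E else ((Num.sqrt (derive1n 2 xi 0))^-1)%:E.

End Mixture.

Section Sphere.
Context {R : realType}.

Definition sphere_N (N : nat) : set (N.-tuple R) :=
  [set s | Num.sqrt (\sum_(i < N) tnth s i ^+ 2) = Num.sqrt N%:R].
#[global] Arguments sphere_N N _ : clear implicits.

Definition mulmx_tuple (N : nat) (O : 'M[R]_N) (s : N.-tuple R) : N.-tuple R :=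
  [tuple \sum_(j < N) O i j * tnth s j | i < N].

(* The uniform law on the sphere: the (unique) Borel probability measure that
   is carried by the sphere and invariant under the orthogonal group. *)
Definition uniform_on_sphere (N : nat) (mu : probability (N.-tuple R) R) : Prop :=
  mu (sphere_N N) = 1%E /\
  forall O : 'M[R]_N, O *m O^T = 1%:M ->
  forall A : set (N.-tuple R), measurable A ->
    mu (mulmx_tuple O @^-1` A) = mu A.

End Sphere.

Section SpinGlass.
Context {R : realType} (gamma : nat -> R).
Context {d : measure_display} {Omega : measurableType d}.
Context (P : probability Omega R).

(* The variables g i, for i in D, are i.i.d. N(0,1); independence is the product
   rule over every finite subfamily. *)
Definition iid_standard_normal (I : choiceType) (D : set I)
    (g : I -> {RV P >-> R}) : Prop :=
  (forall i, D i -> forall A : set R, measurable A ->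
     distribution P (g i) A = normal_prob 0 1 A) /\
  (forall s : seq I, uniq s -> (forall i, i \in s -> D i) ->
     forall A : I -> set R, (forall i, measurable (A i)) ->
     P (\bigcap_(i in [set` s]) (g i @^-1` A i)) =
       (\prod_(i <- s) P (g i @^-1` A i))%E).

(* The coupling g_{i_1,...,i_k} is indexed by the sequence [:: i_1; ...; i_k]
   (numbered from 0); only sequences of size at least 2 occur. *)
Definition is_disorder (g : seq nat -> {RV P >-> R}) : Prop :=
  iid_standard_normal [set s | (2 <= size s)%N] g.

Variable g : seq nat -> {RV P >-> R}.

Definition hamiltonian_term (N k : nat) (s : N.-tuple R) (w : Omega) : R :=
  gamma k / (N%:R `^ ((k%:R - 1) / 2)) *
  \sum_(i : k.-tuple 'I_N)
     g [seq val j | j <- i] w * \prod_(j <- i) tnth s j.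

Definition hamiltonian (N : nat) (s : N.-tuple R) (w : Omega) : R :=
  limn (fun n => \sum_(2 <= k < n) hamiltonian_term k s w).

Variable mu0 : forall N : nat, probability (N.-tuple R) R.

Definition partition_function (N : nat) (beta : R) (w : Omega) : R :=
  \int[mu0 N]_(s in sphere_N N) expR (beta * hamiltonian s w).

Definition free_energy (beta : R) : \bar R :=
  limn (fun N : nat =>
    ((N%:R^-1)%:E * 'E_P[fun w => ln (partition_function N beta w)])%E).

(* Valued in the extended reals, so that no boundedness is presupposed. *)
Definition beta_c : \bar R :=
  ereal_sup [set beta%:E | beta in
    [set beta : R | 0 <= beta /\ free_energy beta = (beta ^+ 2 / 2)%:E]].

End SpinGlass.

Section Parisi.
Context {R : realType} (gamma : nat -> R).
Implicit Type z : probability R R.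

Definition parisi_cdf z (t : R) : R := fine (z `[0, t]%classic).

Definition qhat z : R := inf [set s | z `[0, s]%classic = 1%E].

Definition parisi_admissible z : Prop := z `[0, 1]%classic = 1%E /\ qhat z < 1.

Definition phi z (t : R) : R :=
  \int[lebesgue_measure]_(s in `[t, 1]) parisi_cdf z s.

Definition parisi_functional (beta : R) z : R :=
  2^-1 * (\int[lebesgue_measure]_(t in `[0, 1])
            (beta ^+ 2 * derive1 (xi gamma) t * parisi_cdf z t)
          + \int[lebesgue_measure]_(t in `[0, qhat z]) (phi z t)^-1
          + ln (1 - qhat z)).

(* z is the unique minimizer of the functional at beta, and the minimum is
   the limiting free energy f at beta. *)
Definition is_parisi_measure (f : \bar R) (beta : R) z : Prop :=
  [/\ parisi_admissible z,
      forall z', parisi_admissible z' ->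
        parisi_functional beta z <= parisi_functional beta z',
      forall z', parisi_admissible z' ->
        parisi_functional beta z' = parisi_functional beta z ->
        forall A : set R, measurable A -> z' A = z A
    & f = (parisi_functional beta z)%:E].

Definition measure_support z : set R :=
  [set x | forall U : set R, open U -> U x -> (0 < z U)%E].

Definition qmax z : R := sup (measure_support z).

(* bc is the critical inverse temperature, zeta the family of Parisi measures *)
Definition discontinuous_RSB (bc : \bar R) (zeta : R -> probability R R) : Prop :=
  exists b l : R,
    [/\ bc = b%:E, 0 < l & qmax (zeta beta) @[beta --> b^'+] --> l].

End Parisi.

(* Main.v *)
From HB Require Import structures.
Require Import Defs.
From mathcomp Require Import all_boot all_order all_algebra.
From mathcomp Require Import all_classical all_reals all_analysis.
From mathcomp Require Import measurable_realfun ring lra.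
Import Order.TTheory GRing.Theory Num.Theory.
Import numFieldNormedType.Exports.
Local Open Scope classical_set_scope.
Local Open Scope ring_scope.

(** The contradiction comes from the minimality of the Parisi measures just
    above the critical point.  Write b for the critical inverse temperature and suppose,
    for contradiction, that b^2 xi'(s) <= s/(1-s) for every s in (0,1).

    Let z be the Parisi measure at some beta > b, let c be a level strictly
    below qmax z, and let m = z ]c, oo[ > 0.  Moving the whole mass m lying
    beyond c to the point 0 produces an admissible competitor, whose
    distribution function exceeds that of z by a function w with w = m on
    [0,c] and 0 <= w <= m elsewhere; w vanishes beyond u = qhat z.  The tail
    integral phi grows to phi' = phi + W with W(t) = int_t^u w, and since both
    phi and phi' are at most 1 - t,
      1/phi(t) - 1/phi'(t) = W(t)/(phi(t) phi'(t)) >= W(t)/(1-t)^2.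
    Integrating over [0,u] and exchanging the order of integration turns the
    right-hand side into int w(s) s/(1-s) ds ([inv_tail_gap]).  As z is no
    worse than its competitor, this yields ([displacement_inequality])
      int w(s) s/(1-s) ds <= beta^2 int w(s) xi'(s) ds.

    On the other hand b^2 xi''(0) < 1, because b < beta_cont, and xi'(0) = 0,
    so that s/(1-s) exceeds b^2 xi'(s) by some kappa > 0 on an interval
    [e/2, e] with e <= c.  Together with the assumption on b, the left-hand
    side is at least b^2 int w xi' + kappa m e/2 ([weighted_excess]).  Hence
    kappa e/2 <= (beta^2 - b^2) sup xi', where the factor m has cancelled.
    A discontinuous transition allows one and the same c, hence the same e and
    kappa, for all beta close to b on the right, and letting beta decrease to
    b gives a contradiction ([discontinuity_point]). *)

(** * The derivative of the mixture *)

Lemma bernoulli_ge {R : realDomainType} (s : R) (n : nat) :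
  0 <= s -> 1 + n%:R * s <= (1 + s) ^+ n.
Proof.
move=> s0; elim: n => [|n IHn]; first by rewrite mul0r addr0 expr0.
rewrite exprS (le_trans _ (ler_wpM2l _ IHn)) ?addr_ge0//.
have : 0 <= n%:R * s ^+ 2 by rewrite mulr_ge0 ?ler0n// sqr_ge0.
rewrite -natr1; nra.
Qed.

Lemma is_cvg_series_shiftS {R : realType} (u : nat -> R) :
  cvgn (series u) -> cvgn (series (fun n => u n.+1)).
Proof.
move=> cu; have -> : series (fun n => u n.+1) =
    (fun n => series u n.+1 - u 0).
  apply/funext => n; rewrite /series/= big_nat_recl// addrC addKr.
  by rewrite big_mkord.
apply: is_cvgB; last exact: is_cvg_cst.
by apply/cvg_ex; exists (limn (series u)); rewrite (cvg_shiftS (series u)).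
Qed.

(** Bernoulli's inequality bounds (n+1) s by (1+s)^(n+1) with 1+s = K/rho: the
    factor n+1 brought down by differentiation is absorbed by the passage from
    the radius rho to K. *)
Lemma is_cvg_pseries_diffs_inside {R : realType} (a : nat -> R) (K rho : R) :
  (forall n, 0 <= a n) -> 0 < rho < K -> cvgn (pseries a K) ->
  cvgn (pseries (pseries_diffs a) rho).
Proof.
move=> a0 /andP[r0 rK] aK.
pose s := K / rho - 1.
have s0 : 0 < s by rewrite /s subr_gt0 ltr_pdivlMr// mul1r.
have KE : K = rho * (1 + s).
  by rewrite /s addrC subrK mulrC divfK// gt_eqF.
clearbody s.
have rs0 : 0 < rho * s by exact: mulr_gt0.
rewrite /pseries.
apply: (@series_le_cvg _ _ (fun n => (rho * s)^-1 * (a n.+1 * K ^+ n.+1))).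
- by move=> n; rewrite !mulr_ge0 ?exprn_ge0// ltW.
- move=> n; rewrite mulr_ge0 ?invr_ge0 ?(ltW rs0)// mulr_ge0// exprn_ge0//.
  by rewrite (le_trans _ (ltW rK))// ltW.
- move=> n; rewrite ler_pdivlMl// /pseries_diffs/=.
  rewrite [leLHS](_ : _ = a n.+1 * (rho ^+ n.+1 * (n.+1%:R * s))); last first.
    by rewrite exprS; move: (n.+1%:R) => k; ring.
  rewrite ler_wpM2l// KE exprMn ler_wpM2l ?exprn_ge0 ?(ltW r0)//.
  by rewrite (le_trans _ (bernoulli_ge _ _ (ltW s0)))// lerDr.
- have := is_cvg_series_shiftS _ aK.
  by move=> /(is_cvg_seriesZ (k := (rho * s)^-1)).
Qed.

Lemma pseries_diffs_ge0 {R : realType} (a : nat -> R) :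
  (forall n, 0 <= a n) -> forall n, 0 <= pseries_diffs a n.
Proof. by move=> a0 n; rewrite /pseries_diffs mulr_ge0. Qed.

(** Termwise differentiation asks for convergence of the first two derived
    series at one common point beyond |x|.  Each differentiation costs an
    arbitrarily small part of the radius, so two intermediate radii between
    |x| and K are enough. *)
Lemma is_derive_pseries {R : realType} (a : nat -> R) (K x : R) :
  (forall n, 0 <= a n) -> cvgn (pseries a K) -> `|x| < K ->
  is_derive x 1 (fun y => limn (pseries a y)) (limn (pseries (pseries_diffs a) x)).
Proof.
move=> a0 aK xK.
pose k1 := (`|x| + 2 * K) / 3; pose k2 := (2 * `|x| + K) / 3.
have x0 := normr_ge0 x.
have k20 : `|x| < k2 by rewrite /k2; lra.
have k1K : 0 < k1 < K by rewrite /k1; lra.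
have k21 : 0 < k2 < k1 by rewrite /k2 /k1; lra.
have K0 : 0 < K by lra.
have d1 : cvgn (pseries (pseries_diffs a) k1).
  exact: is_cvg_pseries_diffs_inside k1K aK.
have d2 : cvgn (pseries (pseries_diffs (pseries_diffs a)) k2).
  by apply: is_cvg_pseries_diffs_inside k21 d1; exact: pseries_diffs_ge0.
have [/andP[k1p k1l] /andP[k2p k2l]] := (k1K, k21).
apply: (@pseries_snd_diffs _ _ k2) => //.
- by apply: is_cvg_pseries_inside aK _; rewrite !gtr0_norm// (lt_trans k2l).
- by apply: is_cvg_pseries_inside d1 _; rewrite !gtr0_norm.
- by rewrite (gtr0_norm k2p).
Qed.

(** Padding by two null coefficients makes the mixture a power series indexed
    from 0. *)
Definition mixture_coef {R : realType} (gamma : nat -> R) (k : nat) : R :=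
  if (k < 2)%N then 0 else gamma k ^+ 2.

Lemma mixture_coef_ge0 {R : realType} (gamma : nat -> R) k :
  0 <= mixture_coef gamma k.
Proof. by rewrite /mixture_coef; case: ifP => // _; exact: sqr_ge0. Qed.

Lemma mixture_sumE {R : realType} (gamma : nat -> R) (x : R) :
  (fun n => \sum_(2 <= k < n) gamma k ^+ 2 * x ^+ k) =
  pseries (mixture_coef gamma) x.
Proof.
apply/funext => n; rewrite /pseries/series/=.
have [n2|n2] := leqP n 2.
  rewrite big_geq// big_nat big1// => k /andP[_ kn].
  by rewrite /mixture_coef (leq_trans kn n2) mul0r.
rewrite [RHS](big_cat_nat (n := 2))//; last exact: ltnW.
rewrite [X in _ = X + _]big_nat big1 ?add0r; last first.
  by move=> k /andP[_ k2]; rewrite /mixture_coef k2 mul0r.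
rewrite [LHS]big_nat [RHS]big_nat; apply: eq_bigr => k /andP[k2 _].
by rewrite /mixture_coef ltnNge k2.
Qed.

(** A radius strictly beyond 1 makes xi' regular on the closed interval [0,1],
    the right end point included. *)
Lemma mixture_radius {R : realType} (gamma : nat -> R) : mixture_hyp gamma ->
  exists2 K : R, 1 < K & forall x, `|x| < K ->
    derivable (derive1 (xi gamma)) x 1 /\
    derive1 (xi gamma) x = limn (pseries (pseries_diffs (mixture_coef gamma)) x).
Proof.
move=> [_ [al al0 cK]]; pose D y := limn (pseries (pseries_diffs (mixture_coef gamma)) y).
rewrite /mixture_finite_at mixture_sumE in cK.
exists (1 + al / 2); first by lra.
have a0 := mixture_coef_ge0 gamma.
have xiE : xi gamma = fun x => limn (pseries (mixture_coef gamma) x).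
  by apply/funext => x; rewrite /xi mixture_sumE.
have DE : forall x, `|x| < 1 + al -> derive1 (xi gamma) x = D x.
  move=> x xK; rewrite xiE derive1E.
  by have /@derive_val := is_derive_pseries _ _ _ a0 cK xK.
move=> x xK; split; last by apply: DE; lra.
have dK : cvgn (pseries (pseries_diffs (mixture_coef gamma)) (1 + al / 2)).
  by apply: is_cvg_pseries_diffs_inside a0 _ cK; lra.
have [+ _] := is_derive_pseries _ _ _ (pseries_diffs_ge0 _ a0) dK xK.
apply: near_eq_derivable.
have : \forall y \near x, `|y| < 1 + al / 2.
  exact: (@cvgr_norm_lt _ _ _ _ _ id x cvg_id).
by apply: filterS => y yK; rewrite DE//; lra.
Qed.

Lemma continuous_dxi {R : realType} (gamma : nat -> R) : mixture_hyp gamma ->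
  {within `[0, 1], continuous (derive1 (xi gamma))}.
Proof.
move=> Hxi; have [K K1 dD] := mixture_radius gamma Hxi.
apply: derivable_within_continuous => x; rewrite in_itv/= => /andP[x0 x1].
have [|//] := dD x; rewrite ger0_norm//; lra.
Qed.

Lemma derivable_dxi0 {R : realType} (gamma : nat -> R) : mixture_hyp gamma ->
  derivable (derive1 (xi gamma)) 0 1.
Proof.
move=> Hxi; have [K K1 dD] := mixture_radius gamma Hxi.
have [|//] := dD 0; rewrite normr0; lra.
Qed.

Lemma dxi0 {R : realType} (gamma : nat -> R) : mixture_hyp gamma ->
  derive1 (xi gamma) 0 = 0.
Proof.
move=> Hxi; have [K K1 dD] := mixture_radius gamma Hxi.
have [|_ ->] := dD 0; first by rewrite normr0; lra.
apply/cvg_lim => //; apply: cvg_near_cst; exists 1%N => // n /= n1.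
rewrite /pseries/series/= big_ltn// expr0 mulr1 {1}/pseries_diffs.
(* The constant term of xi' is the linear coefficient of xi, which is null. *)
rewrite /mixture_coef/= mulr0 add0r big_nat big1// => k /andP[k1 _].
by rewrite expr0n gtn_eqF ?mulr0.
Qed.

(** * Two elementary integrals *)

Local Notation mu := lebesgue_measure.

Lemma integral_invsqr_onem {R : realType} (s : R) : 0 <= s < 1 ->
  (\int[mu]_(t in `[0%R, s]) ((1 - t) ^- 2)%:E = (s / (1 - s))%:E)%E.
Proof.
move=> /andP[s0 s1].
have [->|sn0] := eqVneq s 0.
  by rewrite set_itv1 integral_set1 mul0r.
have dF (t : R) : t <= s -> is_derive t 1 (fun t => (1 - t)^-1) ((1 - t) ^- 2).
  move=> ts; have t1 : 1 - t != 0 by rewrite subr_eq0 gt_eqF//; lra.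
  by apply: is_derive_eq; rewrite add0r mul1r scaleNr scalerN opprK [LHS]mulr1.
have cF (t : R) : t <= s -> {for t, continuous (fun t : R => (1 - t)^-1)}.
  move=> ts; apply/differentiable_continuous/derivable1_diffP.
  by have [] := dF t ts.
rewrite (@continuous_FTC2 _ _ (fun t => (1 - t)^-1)).
- rewrite -EFinB subr0 invr1; congr (_%:E); field.
  by rewrite subr_eq0 gt_eqF.
- by rewrite lt_neqAle eq_sym sn0.
- rewrite (_ : (fun t => _) = (fun t => (1 - t)^-1 * (1 - t)^-1)); last first.
    by apply/funext => t; rewrite -invfM.
  apply: derivable_within_continuous => t; rewrite in_itv/= => /andP[_ ts].
  by have [dFt _] := dF t ts; exact: derivableM.
- split.
  + by move=> t; rewrite in_itv/= => /andP[_ /ltW ts]; have [] := dF t ts.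
  + by apply: cvg_at_right_filter; exact: cF.
  + by apply: cvg_at_left_filter; exact: cF.
- move=> t; rewrite in_itv/= => /andP[_ /ltW ts]; rewrite derive1E.
  by have [_ ->] := dF t ts.
Qed.

Lemma integral_inv_onem {R : realType} (a u : R) : a <= u -> u < 1 ->
  (\int[mu]_(t in `[a, u]) ((1 - t)^-1)%:E = (ln (1 - a) - ln (1 - u))%:E)%E.
Proof.
rewrite le_eqVlt => /predU1P[<- _|au u1].
  by rewrite set_itv1 integral_set1 subrr.
have dF (t : R) : t <= u -> is_derive t 1 (fun t => - ln (1 - t)) ((1 - t)^-1).
  move=> tu; have t1 : 0 < 1 - t by lra.
  have := is_derive1_ln t1 => dl.
  by apply: is_derive_eq; rewrite add0r mul1r mulrN1 opprK.
have cF (t : R) : t <= u -> {for t, continuous (fun t : R => - ln (1 - t))}.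
  move=> tu; apply/differentiable_continuous/derivable1_diffP.
  by have [] := dF t tu.
rewrite (@continuous_FTC2 _ _ (fun t => - ln (1 - t)))//.
- by rewrite -EFinB opprK addrC.
- apply: derivable_within_continuous => t; rewrite in_itv/= => /andP[_ ts].
  have t1 : 1 - t != 0 by rewrite subr_eq0 gt_eqF//; lra.
  by apply: derivableV => //; exact: derivableB.
- split.
  + by move=> t; rewrite in_itv/= => /andP[_ /ltW ts]; have [] := dF t ts.
  + by apply: cvg_at_right_filter; exact/cF/ltW.
  + by apply: cvg_at_left_filter; exact: cF.
- move=> t; rewrite in_itv/= => /andP[_ /ltW ts]; rewrite derive1E.
  by have [_ ->] := dF t ts.
Qed.

(** * Exchange of integrals and tail integrals *)

(** Both sides integrate k(t) w(s) over the triangle 0 <= t <= s <= u. *)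
Lemma tonelli_tail {R : realType} (u : R) (k w : R -> R) :
  measurable_fun setT k -> (forall t, 0 <= k t) ->
  measurable_fun setT w -> (forall s, 0 <= w s) ->
  (\int[mu]_(t in `[0%R, u]) ((k t)%:E * \int[mu]_(s in `[t, u]) (w s)%:E) =
   \int[mu]_(s in `[0%R, u]) ((w s)%:E * \int[mu]_(t in `[0%R, s]) (k t)%:E))%E.
Proof.
move=> mk k0 mw w0.
pose f (p : measurableTypeR R * measurableTypeR R) : \bar R :=
  (if (0 <= p.1) && (p.1 <= p.2) && (p.2 <= u) then k p.1 * w p.2 else 0)%:E.
have f0 p : (0 <= f p)%E by rewrite lee_fin; case: ifP => // _; exact: mulr_ge0.
transitivity (\int[mu]_t \int[mu]_s f (t, s))%E.
  rewrite integral_mkcond; apply: eq_integral => t _; rewrite patchE.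
  case: ifPn => [|tn].
    rewrite inE/= in_itv/= => /andP[t0 tu].
    rewrite -ge0_integralZl_EFin//; last 2 first.
    - by move=> s _; rewrite lee_fin.
    - by apply/measurable_EFinP; exact: measurable_funTS.
    rewrite integral_mkcond; apply: eq_integral => s _; rewrite patchE /f/= t0/=.
    by rewrite mem_setE in_itv/= -EFinM; case: ifP.
  rewrite integral0_eq// => s _; rewrite /f/=; case: ifP => // /andP[/andP[t0 ts] su].
  by move: tn; rewrite mem_setE in_itv/= t0 (le_trans ts su).
rewrite (fubini_tonelli f)//; last first.
  apply/measurable_EFinP; apply: measurable_fun_ifT => //.
    apply: measurable_and; first apply: measurable_and.
    - by apply: measurable_fun_ler => //; exact: measurable_fst.
    - by apply: measurable_fun_ler; [exact: measurable_fst|exact: measurable_snd].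
    - by apply: measurable_fun_ler => //; exact: measurable_snd.
  apply: measurable_funM; apply: measurableT_comp => //.
rewrite [RHS]integral_mkcond; apply: eq_integral => s _; rewrite patchE.
case: ifPn => [|sn].
  rewrite inE/= in_itv/= => /andP[s0 su].
  rewrite -ge0_integralZl_EFin//; last 2 first.
  - by move=> t _; rewrite lee_fin.
  - by apply/measurable_EFinP; exact: measurable_funTS.
  rewrite [RHS]integral_mkcond; apply: eq_integral => t _.
  rewrite patchE /f/= su andbT.
  by rewrite mem_setE in_itv/= -EFinM mulrC; case: ifP.
rewrite integral0_eq// => t _; rewrite /f/=; case: ifP => // /andP[/andP[t0 ts] su].
by move: sn; rewrite mem_setE in_itv/= su (le_trans t0 ts).
Qed.

Lemma bounded_itv_integrable {R : realType} (f : R -> R) (a b M : R) :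
  measurable_fun `[a, b] f -> (forall t, a <= t <= b -> `|f t| <= M) ->
  mu.-integrable `[a, b] (EFin \o f).
Proof.
move=> mf fM; apply: measurable_bounded_integrable => //.
  by rewrite /= lebesgue_measure_itv/=; case: ifP => _; rewrite ?ltry// EFinN ltry.
exists M; split; first exact: num_real.
move=> y My t /=; rewrite in_itv/= => tab; exact: le_trans (fM t tab) (ltW My).
Qed.

Definition tail_integral {R : realType} (x : R -> R) (t : R) : R :=
  \int[mu]_(s in `[t, 1]) x s.

Definition cdf_like {R : realType} (x : R -> R) : Prop :=
  measurable_fun setT x /\ forall t, 0 <= x t <= 1.

Lemma cdf_like_integrable {R : realType} (x : R -> R) (a b : R) :
  cdf_like x -> mu.-integrable `[a, b] (EFin \o x).
Proof.
move=> [mx x01]; apply: (@bounded_itv_integrable _ _ _ _ 1).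
  exact: measurable_funTS.
by move=> t _; have /andP[x0 x1] := x01 t; rewrite ger0_norm.
Qed.

Lemma cdf_like_integrable_oc {R : realType} (x : R -> R) (a b : R) :
  cdf_like x -> mu.-integrable `]a, b] (EFin \o x).
Proof.
move=> hx; apply: integrableS (cdf_like_integrable x a b hx) => //.
by apply: subset_itvr; rewrite bnd_simp.
Qed.

Lemma cdf_like_cst1 {R : realType} : cdf_like (cst (1 : R)).
Proof. by split => [|s]; [exact: measurable_cst|rewrite ler01 lexx]. Qed.

Lemma Rintegral_cst_itv {R : realType} (a b r : R) : a <= b ->
  \int[mu]_(s in `[a, b]) (cst r s) = r * (b - a).
Proof.
move=> ab; rewrite Rintegral_cst//= lebesgue_measure_itv/= lte_fin.
by case: ltgtP ab => // -> _; rewrite subrr.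
Qed.

Lemma tail_le {R : realType} (x : R -> R) (t : R) :
  cdf_like x -> t <= 1 -> tail_integral x t <= 1 - t.
Proof.
move=> hx t1; rewrite -[leRHS]mul1r -(Rintegral_cst_itv _ _ 1 t1) /tail_integral.
apply: le_Rintegral => //; first exact: cdf_like_integrable.
  exact: (cdf_like_integrable _ _ _ cdf_like_cst1).
by move=> s _; have [_ /(_ s)/andP[]] := hx.
Qed.

Lemma tail_split {R : realType} (x : R -> R) (t u : R) :
  cdf_like x -> t <= u -> u <= 1 ->
  tail_integral x t = \int[mu]_(s in `[t, u]) x s + tail_integral x u.
Proof.
move=> hx tu u1; apply/eqP; rewrite addrC -subr_eq; apply/eqP.
have it1 : mu.-integrable `[t, 1] (EFin \o x) by exact: cdf_like_integrable.
rewrite /tail_integral (Rintegral_itvB it1) ?bnd_simp// Rintegral_itv_obnd_cbnd//.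
exact: cdf_like_integrable_oc.
Qed.

Lemma tail_ge {R : realType} (x : R -> R) (t u : R) :
  cdf_like x -> (forall s, u < s -> x s = 1) -> t <= u -> u <= 1 ->
  1 - u <= tail_integral x t.
Proof.
move=> hx x1 tu u1; have [_ x01] := hx.
rewrite (tail_split x t u)// ler_wpDl//.
  by apply: Rintegral_ge0 => s _; have /andP[] := x01 s.
have h1 := @cdf_like_cst1 R.
rewrite -[leLHS]mul1r -(Rintegral_cst_itv _ _ 1 u1) /tail_integral.
rewrite -!Rintegral_itv_obnd_cbnd; [|exact: cdf_like_integrable_oc..].
rewrite le_eqVlt; apply/orP; left; apply/eqP; apply: eq_Rintegral => s.
by rewrite inE/= in_itv/= => /andP[us _]; rewrite x1.
Qed.

Lemma tail_nonincreasing {R : realType} (x : R -> R) :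
  cdf_like x -> nonincreasing_fun (tail_integral x).
Proof.
move=> hx s t st; have [_ x01] := hx.
have x0 a b : 0 <= \int[mu]_(r in `[a, b]) x r.
  by apply: Rintegral_ge0 => r _; have /andP[] := x01 r.
have [t1|t1] := leP t 1; first by rewrite (tail_split x s t)// lerDr.
by rewrite {1}/tail_integral set_itv_ge ?bnd_simp -?ltNge// Rintegral_set0; exact: x0.
Qed.

(** Freezing the argument at u keeps the tail integral positive, so that its
    inverse is monotone on the whole line. *)
Lemma measurable_inv_tail {R : realType} (x : R -> R) (u : R) :
  cdf_like x -> 0 < tail_integral x u ->
  measurable_fun setT (fun t : R => (tail_integral x (Num.min t u))^-1).
Proof.
move=> hx xu; apply: nondecreasing_measurable => // s t st.
have xp r : 0 < tail_integral x (Num.min r u).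
  by rewrite (lt_le_trans xu)//; apply: tail_nonincreasing; rewrite // ge_min lexx orbT.
rewrite lef_pV2 ?posrE//; apply: tail_nonincreasing => //.
by rewrite le_min !ge_min st lexx orbT.
Qed.

Lemma inv_tail_integrable {R : realType} (x : R -> R) (a u : R) :
  cdf_like x -> 0 < tail_integral x u ->
  mu.-integrable `[a, u] (EFin \o (fun t => (tail_integral x t)^-1)).
Proof.
move=> hx xu; apply: (@bounded_itv_integrable _ _ _ _ (tail_integral x u)^-1).
  apply: eq_measurable_fun (measurable_funTS (measurable_inv_tail x u hx xu)).
  by move=> t; rewrite inE/= in_itv/= => /andP[_ tu]; rewrite (min_idPl tu).
move=> t /andP[_ tu].
have xt : 0 < tail_integral x t by rewrite (lt_le_trans xu)//; exact: tail_nonincreasing.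
rewrite ger0_norm ?invr_ge0 ?(ltW xt)// lef_pV2 ?posrE//.
exact: tail_nonincreasing.
Qed.

(** Both tail integrals are at most 1 - t, so 1/phi - 1/phi' >= W/(1-t)^2 with
    W the increment of the tail integral; by Tonelli the weight s/(1-s) is the
    integral of 1/(1-t)^2 over [0,s]. *)
Lemma inv_tail_gap {R : realType} (x x' : R -> R) (u : R) :
  cdf_like x -> cdf_like x' -> (forall t, x t <= x' t) ->
  0 <= u < 1 -> (forall s, u < s -> x s = 1) ->
  \int[mu]_(s in `[0, u]) ((x' s - x s) * (s / (1 - s))) <=
  \int[mu]_(t in `[0, u]) (tail_integral x t)^-1 - \int[mu]_(t in `[0, u]) (tail_integral x' t)^-1.
Proof.
move=> hx hx' xx' /andP[u0 u1] xu.
have [[mx x01] [mx' x01']] := (hx, hx').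
have xu' s : u < s -> x' s = 1.
  move=> us; apply/eqP; rewrite eq_le; have /andP[_ ->] := x01' s.
  by rewrite /= -(xu s us) xx'.
have tp : 0 < tail_integral x u by rewrite (lt_le_trans _ (tail_ge x u u hx _ _ _)) ?subr_gt0// ltW.
have tp' : 0 < tail_integral x' u by rewrite (lt_le_trans _ (tail_ge x' u u hx' _ _ _)) ?subr_gt0// ltW.
pose w s := x' s - x s.
have w0 s : 0 <= w s by rewrite subr_ge0.
have w1 s : w s <= 1 by rewrite /w; have := x01 s; have := x01' s; lra.
have mw : measurable_fun setT w by exact: measurable_funB.
have hw : cdf_like w by split => // s; rewrite w0 w1.
(* Freezing the kernel at u makes it monotone, hence measurable, on the whole
   line. *)
pose k t : R := (1 - Num.min t u) ^- 2.
have m1 t : 0 < 1 - Num.min t u.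
  by rewrite subr_gt0 (le_lt_trans _ u1)// ge_min lexx orbT.
have k0 t : 0 <= k t by rewrite invr_ge0 sqr_ge0.
have mk : measurable_fun setT k.
  apply: nondecreasing_measurable => // s t st.
  rewrite lef_pV2 ?posrE ?exprn_gt0// lerXn2r ?nnegrE ?(ltW (m1 _))//.
  by rewrite lerB// le_min !ge_min st lexx orbT.
have iG : mu.-integrable `[0, u] (EFin \o (fun t => (tail_integral x t)^-1 - (tail_integral x' t)^-1)).
  by apply: (integrableB _ (inv_tail_integrable x 0 u hx tp)
                           (inv_tail_integrable x' 0 u hx' tp')).
rewrite -RintegralB//; [|exact: inv_tail_integrable..].
have wE : (\int[mu]_(s in `[0%R, u]) (w s * (s / (1 - s)))%:E =
    \int[mu]_(t in `[0%R, u]) ((k t)%:E * \int[mu]_(s in `[t, u]) (w s)%:E))%E.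
  rewrite tonelli_tail//; apply: eq_integral => s.
  rewrite inE/= in_itv/= => /andP[s0 su]; rewrite EFinM; congr (_ * _)%E.
  rewrite -integral_invsqr_onem ?s0 ?(le_lt_trans su)//; apply: eq_integral => t.
  by rewrite inE/= in_itv/= => /andP[_ ts]; rewrite /k (min_idPl (le_trans ts su)).
have wtailE t : t <= u -> \int[mu]_(s in `[t, u]) w s = tail_integral x' t - tail_integral x t.
  move=> tu; rewrite (tail_split x t u)// ?(tail_split x' t u)// ?(ltW u1)//.
  rewrite RintegralB//; [|exact: cdf_like_integrable..].
  suff -> : tail_integral x' u = tail_integral x u by lra.
  rewrite /tail_integral -!Rintegral_itv_obnd_cbnd; [|exact: cdf_like_integrable_oc..].
  by apply: eq_Rintegral => s; rewrite inE/= in_itv/= => /andP[us _]; rewrite xu// xu'.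
have D0 t : 0 <= tail_integral x' t - tail_integral x t.
  by rewrite subr_ge0 /tail_integral; apply: le_Rintegral => //; exact: cdf_like_integrable.
have gapE t : 0 <= t <= u ->
    k t * (tail_integral x' t - tail_integral x t) <= (tail_integral x t)^-1 - (tail_integral x' t)^-1.
  move=> /andP[t0 tu].
  have tpt : 0 < tail_integral x t by rewrite (lt_le_trans tp)//; exact: tail_nonincreasing.
  have tpt' : 0 < tail_integral x' t by rewrite (lt_le_trans tp')//; exact: tail_nonincreasing.
  rewrite /k (min_idPl tu).
  have t1 : t <= 1 by lra.
  have := tail_le x t hx t1; have := tail_le x' t hx' t1.
  move: (tail_integral x t) (tail_integral x' t) tpt tpt' (D0 t) => p p' p0 p0' {}D0 p'1 p1.
  have -> : p^-1 - p'^-1 = (p * p')^-1 * (p' - p) by field; rewrite !gt_eqF.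
  have t0' : 0 < 1 - t by lra.
  rewrite ler_wpM2r// lef_pV2 ?posrE ?mulr_gt0 ?exprn_gt0//.
  by rewrite expr2 ler_pM// ltW.
(* Tonelli's theorem lives in the extended reals; finiteness of the dominating
   side brings the comparison back to real integrals. *)
have LE : (\int[mu]_(s in `[0%R, u]) (w s * (s / (1 - s)))%:E <=
    \int[mu]_(t in `[0%R, u]) ((tail_integral x t)^-1 - (tail_integral x' t)^-1)%:E)%E.
  have kE : (\int[mu]_(t in `[0%R, u]) ((k t)%:E * \int[mu]_(s in `[t, u]) (w s)%:E) =
      \int[mu]_(t in `[0%R, u]) (k t * (tail_integral x' t - tail_integral x t))%:E)%E.
    apply: eq_integral => t; rewrite inE/= in_itv/= => /andP[_ tu].
    rewrite EFinM -wtailE// /Rintegral fineK//.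
    by apply: integrable_fin_num => //; exact: cdf_like_integrable.
  rewrite wE kE; apply: ge0_le_integral => //.
  - by move=> t _; rewrite lee_fin mulr_ge0.
  - apply/measurable_EFinP; apply: measurable_funM.
      exact: measurable_funTS.
    by apply: measurable_funB; apply: nonincreasing_measurable => //; exact: tail_nonincreasing.
  - by case/integrableP : iG.
have RF := integrable_fin_num _ iG.
apply: (fine_le _ _ LE); last exact: RF.
rewrite ge0_fin_numE.
  by apply: le_lt_trans LE _; rewrite ltey_eq RF.
by apply: integral_ge0 => s; rewrite /= in_itv/= => /andP[s0 su];
  rewrite lee_fin mulr_ge0 ?w0// divr_ge0//; lra.
Qed.
(** * Distribution functions of Parisi measures *)

(** The logarithmic term compensates the integral of 1/(1-t), a lower bound for
    the inverse of a tail integral.  Hence measures with different values of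
    qhat can be compared over one common interval [0,u]. *)
Lemma log_cut_le {R : realType} (x : R -> R) (a u : R) :
  cdf_like x -> 0 < tail_integral x u -> 0 <= a -> a <= u -> u < 1 ->
  \int[mu]_(t in `[0, a]) (tail_integral x t)^-1 + ln (1 - a) <=
  \int[mu]_(t in `[0, u]) (tail_integral x t)^-1 + ln (1 - u).
Proof.
move=> hx xu a0 au u1; have [_ x01] := hx.
have iu b := inv_tail_integrable x b u hx xu.
suff : ln (1 - a) - ln (1 - u) <=
    \int[mu]_(t in `[0, u]) (tail_integral x t)^-1 - \int[mu]_(t in `[0, a]) (tail_integral x t)^-1 by lra.
rewrite (Rintegral_itvB (iu 0)) ?bnd_simp// Rintegral_itv_obnd_cbnd; last first.
  by apply: integrableS (iu a) => //; apply: subset_itvr; rewrite bnd_simp.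
have -> : ln (1 - a) - ln (1 - u) = \int[mu]_(t in `[a, u]) (1 - t)^-1.
  by rewrite /Rintegral integral_inv_onem.
apply: le_Rintegral => //.
  apply: continuous_compact_integrable; first exact: segment_compact.
  apply: derivable_within_continuous => t; rewrite in_itv/= => /andP[_ tu].
  have t1 : 1 - t != 0 by rewrite subr_eq0 gt_eqF//; lra.
  by apply: derivableV => //; exact: derivableB.
move=> t; rewrite /= in_itv/= => /andP[_ tu].
have xt : 0 < tail_integral x t by rewrite (lt_le_trans xu)//; exact: tail_nonincreasing.
rewrite lef_pV2 ?posrE//; first by apply: tail_le => //; lra.
by lra.
Qed.

Lemma parisi_cdf_nondecreasing {R : realType} (z : probability R R) : nondecreasing_fun (parisi_cdf z).
Proof.
move=> s t st; rewrite /parisi_cdf fine_le ?fin_num_measure//.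
apply: le_measure; rewrite ?inE//; apply: subset_itvl.
by rewrite bnd_simp.
Qed.

Lemma parisi_cdf_cdf_like {R : realType} (z : probability R R) : cdf_like (parisi_cdf z).
Proof.
split; first by apply: nondecreasing_measurable => //; exact: parisi_cdf_nondecreasing.
move=> t; rewrite /parisi_cdf fine_ge0//= -lee_fin fineK ?fin_num_measure//.
exact: probability_le1.
Qed.

Lemma full_mass_ge0 {R : realType} (z : probability R R) s :
  z `[0, s]%classic = 1%E -> 0 <= s.
Proof.
move=> zs; rewrite leNgt; apply/negP => s0; move: zs.
rewrite set_itv_ge ?bnd_simp -?ltNge// measure0 => /eqP.
by rewrite eqe eq_sym oner_eq0.
Qed.

Lemma qhat_le {R : realType} (z : probability R R) s : z `[0, s]%classic = 1%E -> qhat z <= s.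
Proof.
by move=> zs; apply: ge_inf => //; exists 0 => r; exact: full_mass_ge0.
Qed.

Lemma qhat_ge {R : realType} (z : probability R R) c : z `[0, 1]%classic = 1%E ->
  (forall s, z `[0, s]%classic = 1%E -> c <= s) -> c <= qhat z.
Proof. by move=> z1 cs; apply: lb_le_inf => //; exists 1. Qed.

Lemma parisi_cdf_eq1 {R : realType} (z : probability R R) t : z `[0, 1]%classic = 1%E -> qhat z < t ->
  parisi_cdf z t = 1.
Proof.
move=> z1 qt.
have hS : has_inf [set s | z `[0, s]%classic = 1%E].
  by split; [exists 1|exists 0 => r; exact: full_mass_ge0].
have [s /= zs] := @inf_adherent _ _ (t - qhat z) ltac:(by rewrite subr_gt0) hS.
rewrite addrC subrK => st.
have /andP[_ c1] := (parisi_cdf_cdf_like z).2 t.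
apply/eqP; rewrite eq_le c1 (le_trans _ (parisi_cdf_nondecreasing z _ _ (ltW st)))//.
by rewrite /parisi_cdf zs.
Qed.

Lemma exists_pushforward {R : realType} (z : probability R R) (T : R -> R) : measurable_fun setT T ->
  exists z' : probability R R, forall A, z' A = z (T @^-1` A).
Proof.
move=> mT; pose X : {mfun R >-> R} := HB.pack T (isMeasurableFun.Build _ _ _ _ T mT).
by exists (distribution z X).
Qed.

Lemma measure_gt_qmax {R : realType} (z : probability R R) c : 0 <= c -> c < qmax z -> (0 < z `]c, +oo[%classic)%E.
Proof.
move=> c0 cq.
have hS : has_sup (measure_support z).
  by apply: contrapT => /sup_out; rewrite -/(qmax z) => q0; rewrite q0 ltNge c0 in cq.
have [y /= zy] := @sup_adherent _ _ (qmax z - c) ltac:(by rewrite subr_gt0) hS.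
rewrite -/(qmax z) opprB addrC subrK => cy.
by apply: zy; [exact: interval_open|rewrite /= in_itv/= cy].
Qed.

Lemma parisi_cdf_tailE {R : realType} (z : probability R R) c : z `[0, 1]%classic = 1%E -> 0 <= c ->
  (z `]c, +oo[%classic = (1 - parisi_cdf z c)%:E)%E.
Proof.
move=> z1 c0.
have zoo : z `[0, +oo[%classic = 1%E.
  apply/eqP; rewrite eq_le probability_le1//= -z1.
  by apply: le_measure; rewrite ?inE//; apply: subset_itvl; rewrite bnd_simp.
move: zoo; rewrite (@itv_bndbnd_setU _ _ (BLeft 0) (BRight c) +oo%O) ?bnd_simp//.
rewrite measureU//; last first.
  apply/seteqP; split => // s []; rewrite /= !in_itv/= => /andP[_ sc].
  by rewrite andbT ltNge sc.
move=> /eqP; rewrite addeC eq_sym -sube_eq ?fin_num_measure//; last first.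
  by rewrite fin_num_adde_defl// fin_num_measure.
by move=> /eqP <-; rewrite EFinB /parisi_cdf fineK ?fin_num_measure.
Qed.

(** The competitor: the image of z under the map that sends everything beyond c
    to 0 and fixes the rest. *)
Lemma displaced_measure {R : realType} (z : probability R R) c : z `[0, 1]%classic = 1%E -> 0 <= c ->
  exists z' : probability R R,
    [/\ forall t, 0 <= t <= c -> parisi_cdf z' t = parisi_cdf z t + (1 - parisi_cdf z c),
        z' `[0, c]%classic = 1%E
      & forall t, t < 0 -> parisi_cdf z' t = parisi_cdf z t].
Proof.
move=> z1 c0.
pose T (s : R) : R := if s <= c then s else 0.
have mT : measurable_fun setT T.
  apply: measurable_fun_ifT => //.
  by apply: measurable_fun_ler => //; exact: measurable_cst.
have [z' z'E] := exists_pushforward z T mT; exists z'.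
have cdfE t : 0 <= t <= c -> parisi_cdf z' t = parisi_cdf z t + (1 - parisi_cdf z c).
  move=> /andP[t0 tc].
  rewrite /parisi_cdf z'E.
  have -> : T @^-1` `[0, t] = `[0, t]%classic `|` `]c, +oo[%classic.
    apply/seteqP; split => s /=; rewrite !in_itv/= /T andbT.
      by case: (leP s c) => sc; [left|right].
    move=> [/andP[s0 st]|cs]; first by rewrite (le_trans st tc) s0 st.
    by rewrite (leNgt s c) cs/= lexx t0.
  rewrite measureU//; last first.
    apply/seteqP; split => // s []; rewrite /= !in_itv/= => /andP[_ st].
    by rewrite andbT ltNge (le_trans st tc).
  rewrite fineD ?fin_num_measure//; congr (_ + _).
  by have /= -> := parisi_cdf_tailE z c z1 c0.
split=> //.
  have := cdfE c; rewrite c0 lexx => /(_ isT); rewrite addrC subrK => c1.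
  by rewrite -[LHS]fineK ?fin_num_measure// -/(parisi_cdf z' c) c1.
by move=> t t0; rewrite /parisi_cdf set_itv_ge ?bnd_simp -?ltNge// !measure0.
Qed.

(** * The displacement inequality *)

(** First-order information extracted from one finite comparison: z is compared
    with its displaced version, and w is the increment of the distribution
    function, m the mass that is moved and u = qhat z. *)
Lemma displacement_inequality {R : realType} (gamma : nat -> R) (beta M c : R)
    (z : probability R R) :
  measurable_fun `[(0 : R), 1] (derive1 (xi gamma)) ->
  (forall t, 0 <= t <= 1 -> `|derive1 (xi gamma) t| <= M) ->
  parisi_admissible z ->
  (forall z', parisi_admissible z' ->
     parisi_functional gamma beta z <= parisi_functional gamma beta z') ->
  0 <= c < qmax z ->
  exists (w : R -> R) (u m : R),
    [/\ 0 < m, c <= u < 1, measurable_fun setT w,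
        forall t, 0 <= w t <= m /\ (0 <= t <= c -> w t = m)
      & \int[mu]_(s in `[0, u]) (w s * (s / (1 - s))) <=
        beta ^+ 2 * \int[mu]_(s in `[0, u]) (derive1 (xi gamma) s * w s)].
Proof.
move=> mG GM [z1 q1] zmin /andP[c0 cq].
set G := derive1 (xi gamma) in mG GM *.
have m0 : 0 < 1 - parisi_cdf z c.
  rewrite -lte_fin; have /= <- := parisi_cdf_tailE z c z1 c0.
  exact: measure_gt_qmax.
have cu : c <= qhat z.
  apply: qhat_ge => // s zs; rewrite leNgt; apply/negP => sc.
  have := parisi_cdf_nondecreasing z _ _ (ltW sc).
  by rewrite {1}/parisi_cdf zs/=; lra.
have [z' [cdfE z'c cdfN]] := displaced_measure z c z1 c0.
have hx := parisi_cdf_cdf_like z; have hx' := parisi_cdf_cdf_like z'.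
have z'1 : z' `[0, 1]%classic = 1%E.
  apply/eqP; rewrite eq_le probability_le1//= -z'c.
  by apply: le_measure; rewrite ?inE//; apply: subset_itvl; rewrite bnd_simp; lra.
have q'c : qhat z' <= c by exact: qhat_le.
have q'0 : 0 <= qhat z' by apply: qhat_ge => // s; exact: full_mass_ge0.
have adm' : parisi_admissible z' by split => //; lra.
have cdfC t : c <= t -> parisi_cdf z' t = 1.
  move=> ct; have /andP[_ c1] := hx'.2 t; apply/eqP; rewrite eq_le c1/=.
  by rewrite (le_trans _ (parisi_cdf_nondecreasing z' _ _ ct))// /parisi_cdf z'c.
set x := parisi_cdf z in m0 cdfE cdfN hx *; set x' := parisi_cdf z' in cdfE cdfN hx' cdfC.
have w01 t : 0 <= x' t - x t <= 1 - x c /\ (0 <= t <= c -> x' t - x t = 1 - x c).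
  split; last by move=> /cdfE ->; lra.
  have [t0|t0] := ltP t 0; first by rewrite cdfN// subrr lexx ltW.
  have [tc|/ltW ct] := leP t c; first by rewrite cdfE ?t0//; lra.
  rewrite cdfC//; have := hx.2 t; have := parisi_cdf_nondecreasing z _ _ ct.
  by rewrite -/x; lra.
have xu t : qhat z < t -> x t = 1 by exact: parisi_cdf_eq1.
have tu : 0 < tail_integral x (qhat z).
  by rewrite (lt_le_trans _ (tail_ge x _ _ hx xu _ _)) ?subr_gt0// ltW.
have xx' t : x t <= x' t by have [] := w01 t; lra.
have tu' : 0 < tail_integral x' (qhat z).
  rewrite (lt_le_trans tu)// /tail_integral; apply: le_Rintegral => //; exact: cdf_like_integrable.
exists (fun t => x' t - x t), (qhat z), (1 - x c); split => //.
- by rewrite cu.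
- by apply: measurable_funB; [exact: hx'.1|exact: hx.1].
have GI f : cdf_like f -> mu.-integrable `[0, 1] (EFin \o (fun t => G t * f t)).
  move=> [mf f01]; apply: (@bounded_itv_integrable _ _ _ _ M).
    by apply: measurable_funM => //; exact: measurable_funTS.
  move=> t t01; rewrite normrM -[leRHS]mulr1 ler_pM//; first exact: GM.
  by have /andP[f0 f1] := f01 t; rewrite ger0_norm.
have PE (y : probability R R) : cdf_like (parisi_cdf y) ->
    parisi_functional gamma beta y =
    2^-1 * (beta ^+ 2 * \int[mu]_(t in `[0, 1]) (G t * parisi_cdf y t) +
      (\int[mu]_(t in `[0, qhat y]) (tail_integral (parisi_cdf y) t)^-1 + ln (1 - qhat y))).
  move=> hy; rewrite /parisi_functional -addrA; congr (_ * (_ + _)).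
  rewrite -RintegralZl//; last exact: GI.
  by apply: eq_Rintegral => t _; rewrite mulrA.
have := zmin z' adm'; rewrite !PE// -/x -/x'.
have q1' : qhat z < 1 by [].
have u0 : 0 <= qhat z by lra.
have gap := inv_tail_gap x x' (qhat z) hx hx' xx' ltac:(by rewrite u0 q1') xu.
have cut := log_cut_le x' (qhat z') (qhat z) hx' tu' q'0 (le_trans q'c cu) q1'.
have -> : \int[mu]_(s in `[0, qhat z]) (G s * (x' s - x s)) =
    \int[mu]_(s in `[0, 1]) (G s * x' s) - \int[mu]_(s in `[0, 1]) (G s * x s).
  rewrite -RintegralB//; [|exact: GI..].
  have hw : cdf_like (fun s => x' s - x s).
    split; first by apply: measurable_funB; [exact: hx'.1|exact: hx.1].
    move=> s; rewrite subr_ge0 xx'/=.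
    by have /andP[xs0 _] := hx.2 s; have /andP[_ xs1] := hx'.2 s; rewrite lerBlDr (le_trans xs1)// lerDl.
  transitivity (\int[mu]_(s in `[0, 1]) (G s * (x' s - x s))); last first.
    by apply: eq_Rintegral => s _; rewrite mulrBr.
  apply/esym/eqP; rewrite -subr_eq0; apply/eqP; rewrite (Rintegral_itvB (GI _ hw)) ?bnd_simp// ?ltW//.
  transitivity (\int[mu]_(s in `]qhat z, 1]) (cst 0 s)); last first.
    by rewrite Rintegral_cst// mul0r.
  apply: eq_Rintegral => s; rewrite inE/= in_itv/= => /andP[us _].
  by rewrite xu// cdfC ?subrr ?mulr0// (le_trans cu)// ltW.
rewrite ler_pM2l ?invr_gt0// mulrBr.
move: gap cut.
move: (\int[mu]_(t in _) (tail_integral x t)^-1) => A.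
move: (\int[mu]_(t in `[0, qhat z]) (tail_integral x' t)^-1) => B.
move: (\int[mu]_(t in _) (tail_integral x' t)^-1) => C.
move: (\int[mu]_(t in _) (_ * (t / _))) (_ * _) (_ * _) (ln _) (ln _).
by clear; move=> *; lra.
Qed.

(** * Excess near the origin and conclusion *)

Lemma derivable_below_line {R : realType} (f : R -> R) (r : R) :
  derivable f 0 1 -> f 0 = 0 -> derive1 f 0 < r ->
  \forall t \near 0^'+, f t < r * t.
Proof.
move=> df f0 fr.
have cf : h^-1 * f h @[h --> 0^'] --> derive1 f 0.
  rewrite /derive1.
  have E : (fun h : R => h^-1 *: (f (h *: 1 + 0) - f 0)) =
      (fun h => h^-1 *: (f (h + 0) - f 0)).
    by apply/funext => h; rewrite [h *: 1]mulr1.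
  move: df; rewrite /derivable E => /cvgP; rewrite /=.
  by under eq_fun do rewrite addr0 f0 subr0.
have cf' : h^-1 * f h @[h --> 0^'+] --> derive1 f 0.
  exact: cvg_dnbhs_at_right cf.
near=> t.
have t0 : 0 < t by near: t; exact: nbhs_right_gt.
rewrite mulrC -ltr_pdivrMl//.
near: t; exact: (cvgr_lt _ cf').
Unshelve. all: by end_near. Qed.

Lemma odds_weight_integrable {R : realType} (w : R -> R) (u m : R) :
  measurable_fun setT w -> (forall s, 0 <= w s <= m) -> u < 1 ->
  mu.-integrable `[0, u] (EFin \o (fun s => w s * (s / (1 - s)))).
Proof.
move=> mw wm u1.
apply: (@bounded_itv_integrable _ _ _ _ (m * (1 - u)^-1)).
  apply: measurable_funM; first exact: measurable_funTS.
  apply: subspace_continuous_measurable_fun => //.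
  apply: derivable_within_continuous => t; rewrite in_itv/= => /andP[_ tu].
  have t1 : 1 - t != 0 by rewrite subr_eq0 gt_eqF//; lra.
  by apply: derivableM => //; apply: derivableV => //; exact: derivableB.
move=> t /andP[t0 tu]; have /andP[w0 wm'] := wm t.
have t1 : 0 < 1 - t by lra.
have u1' : 0 < 1 - u by lra.
rewrite ger0_norm ?mulr_ge0 ?invr_ge0 ?(ltW t1)// ler_pM// ?mulr_ge0 ?invr_ge0 ?(ltW t1)//.
rewrite -[leRHS]mul1r ler_pM// ?invr_ge0 ?(ltW t1)//; first by lra.
by rewrite lef_pV2 ?posrE//; lra.
Qed.

Lemma weighted_integral_le {R : realType} (G w : R -> R) (u m M : R) :
  measurable_fun `[(0 : R), 1] G -> (forall t, 0 <= t <= 1 -> `|G t| <= M) ->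
  measurable_fun setT w -> (forall s, 0 <= w s <= m) -> 0 <= u <= 1 ->
  mu.-integrable `[0, u] (EFin \o (fun s => G s * w s)) /\
  \int[mu]_(s in `[0, u]) (G s * w s) <= M * m.
Proof.
move=> mG GM mw wm /andP[u0 u1].
have Gw s : 0 <= s <= u -> `|G s * w s| <= M * m.
  move=> /andP[s0 su]; have /andP[ws0 wsm] := wm s.
  rewrite normrM (ger0_norm ws0) ler_pM//; apply: GM; rewrite s0/=.
  exact: le_trans u1.
have iGw : mu.-integrable `[0, u] (EFin \o (fun s => G s * w s)).
  apply: (@bounded_itv_integrable _ _ _ _ (M * m)) => //.
  apply: measurable_funM; last exact: measurable_funTS.
  by apply: measurable_funS mG => //; apply: subset_itvl; rewrite bnd_simp.
split => //.
have Mm0 : 0 <= M * m by apply: le_trans (Gw 0 _); rewrite ?lexx.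
have ic : mu.-integrable `[0, u] (EFin \o cst (M * m)).
  apply: (@bounded_itv_integrable _ _ _ _ (M * m)) => //.
  by move=> t _; rewrite ger0_norm.
apply: (@le_trans _ _ (\int[mu]_(s in `[0, u]) (cst (M * m) s))).
  apply: le_Rintegral => // s; rewrite /= in_itv/= => s0u.
  exact: le_trans (ler_norm _) (Gw s s0u).
by rewrite Rintegral_cst_itv// subr0 ler_piMr.
Qed.

(** The slack kappa available on [e1, e2], where w equals m, contributes
    kappa m (e2 - e1) to the integrated inequality. *)
Lemma weighted_excess {R : realType} (G w : R -> R) (a u m M kappa e1 e2 : R) :
  measurable_fun `[(0 : R), 1] G -> (forall t, 0 <= t <= 1 -> `|G t| <= M) ->
  measurable_fun setT w -> (forall s, 0 <= w s <= m) ->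
  0 <= e1 -> e1 <= e2 -> e2 <= u -> u < 1 -> 0 <= kappa ->
  (forall s, 0 <= s <= u -> a * G s <= s / (1 - s)) ->
  (forall s, e1 <= s <= e2 -> w s = m /\ a * G s + kappa <= s / (1 - s)) ->
  a * \int[mu]_(s in `[0, u]) (G s * w s) + kappa * m * (e2 - e1) <=
  \int[mu]_(s in `[0, u]) (w s * (s / (1 - s))).
Proof.
move=> mG GM mw wm e10 e12 e2u u1 kappa0 Ga Gk.
have u0 : 0 <= u by lra.
have [iGw _] := weighted_integral_le G w u m M mG GM mw wm ltac:(by rewrite u0 ltW).
have iI : mu.-integrable `[0, u] (EFin \o (fun s => kappa * m * \1_(`[e1, e2]) s)).
  apply: (@bounded_itv_integrable _ _ _ _ `|kappa * m|).
    apply: measurable_funM; first exact: measurable_cst.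
    exact: measurable_indic.
  by move=> t _; rewrite normrM ler_piMr// indicE; case: (_ \in _); rewrite ?normr1 ?normr0.
have -> : kappa * m * (e2 - e1) = \int[mu]_(s in `[0, u]) (kappa * m * \1_(`[e1, e2]) s).
  rewrite -(Rintegral_cst_itv _ _ _ e12) [LHS]Rintegral_mkcond [RHS]Rintegral_mkcond.
  apply: eq_Rintegral => s _; rewrite !patchE indicE !mem_setE !in_itv/=.
  case: (boolP (e1 <= s <= e2)) => [/andP[es se]|_].
    by rewrite (le_trans e10 es) (le_trans se e2u) mulr1.
  by rewrite mulr0; case: ifP.
have iaGw : mu.-integrable `[0, u] (EFin \o (fun s => a * (G s * w s))).
  exact: (integrableZl _ a iGw).
rewrite -RintegralZl// -RintegralD//.
apply: le_Rintegral => //.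
- exact: (integrableD _ iaGw iI).
- exact: odds_weight_integrable.
move=> s; rewrite /= in_itv/= => s0u; have /andP[ws0 _] := wm s.
rewrite indicE mem_setE in_itv/=.
case: (boolP (e1 <= s <= e2)) => [es|_].
  have [wsm Gks] := Gk s es; rewrite wsm mulr1.
  rewrite [leLHS](_ : _ = m * (a * G s + kappa)); last by ring.
  by rewrite ler_wpM2l// -wsm.
rewrite mulr0 addr0 mulrA mulrC; apply: ler_wpM2l => //.
exact: Ga.
Qed.

Lemma beta_lt_cont {R : realType} (gamma : nat -> R) (b : R) :
  0 <= b -> (b%:E < beta_cont gamma)%E ->
  b ^+ 2 * derive1 (derive1 (xi gamma)) 0 < 1.
Proof.
move=> b0; rewrite /beta_cont /=; set y := derive1 _ 0.
case: eqP => [-> _|/eqP y0]; first by rewrite mulr0.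
rewrite lte_fin => bs.
have [y0'|y0'] := leP y 0.
  by rewrite (le_lt_trans _ ltr01)// mulr_ge0_le0// sqr_ge0.
have s0 : 0 < Num.sqrt y by rewrite sqrtr_gt0.
rewrite -(sqr_sqrtr (ltW y0')) -exprMn expr_lt1//; last first.
  by rewrite mulr_ge0// ltW.
by rewrite -ltr_pdivlMr// mul1r.
Qed.

(** The level c lies below all qmax (zeta beta) for beta near b, so the interval
    [e/2, e] and the slack kappa do not depend on beta, while the displacement
    inequality bounds kappa e/2 by (beta^2 - b^2) M. *)
Lemma discontinuity_point {R : realType} (gamma : nat -> R)
    (zeta : R -> probability R R) (b l : R) :
  mixture_hyp gamma ->
  (forall beta, 0 <= beta -> parisi_admissible (zeta beta) /\
     forall z, parisi_admissible z ->
       parisi_functional gamma beta (zeta beta) <= parisi_functional gamma beta z) ->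
  0 <= b -> 0 < l -> qmax (zeta beta) @[beta --> b^'+] --> l ->
  b ^+ 2 * derive1 (derive1 (xi gamma)) 0 < 1 ->
  exists q, 0 < q < 1 /\ q / (1 - q) < b ^+ 2 * derive1 (xi gamma) q.
Proof.
move=> Hxi Hzeta b0 l0 ql; set G := derive1 (xi gamma) => bG.
apply: contrapT => /forallNP noq.
have sub q : 0 < q < 1 -> b ^+ 2 * G q <= q / (1 - q).
  move=> q01; rewrite leNgt; apply/negP => qG; exact: (noq q).
have cG := continuous_dxi gamma Hxi.
have mG : measurable_fun `[(0 : R), 1] G.
  exact: subspace_continuous_measurable_fun.
have [M M0 GM] : exists2 M : R, 0 < M & forall t, 0 <= t <= 1 -> `|G t| <= M.
  have /compact_bounded[M [_ MG]] := continuous_compact cG (segment_compact (a := 0) (b := 1)).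
  exists (Num.max (M + 1) 1); first by rewrite lt_max ltr01 orbT.
  move=> t t01; apply: MG; first by rewrite lt_max ltrDl ltr01.
  by exists t => //; rewrite /= in_itv.
(* A slope strictly between xi''(0) and 1/b^2, also meaningful when b = 0. *)
pose r := derive1 G 0 + (1 - b ^+ 2 * derive1 G 0) / (2 * (b ^+ 2 + 1)).
have b20 : 0 <= b ^+ 2 by exact: sqr_ge0.
have G0r : derive1 G 0 < r by rewrite /r ltrDl divr_gt0//; lra.
have br1 : b ^+ 2 * r < 1.
  rewrite /r; move: (derive1 G 0) (b ^+ 2) bG b20 => y a ay a0.
  have -> : a * (y + (1 - a * y) / (2 * (a + 1))) =
    1 - (1 - a * y) * ((a + 2) / (2 * (a + 1))) by field; lra.
  have : 0 < (1 - a * y) * ((a + 2) / (2 * (a + 1))).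
    by rewrite mulr_gt0 ?divr_gt0//; lra.
  by lra.
have [e0 /= e00 He0] :=
  derivable_below_line G r (derivable_dxi0 gamma Hxi) (dxi0 gamma Hxi) G0r.
pose c := l / 2.
have c0 : 0 < c by exact: divr_gt0.
have cl : c < l by rewrite /c; lra.
pose e := Num.min c (e0 / 2).
have e_gt0 : 0 < e by rewrite lt_min c0 divr_gt0.
have ec : e <= c by rewrite ge_min lexx.
have ee0 : e < e0 by rewrite gt_min; apply/orP; right; lra.
pose kappa := (1 - b ^+ 2 * r) * (e / 2).
have kappa0 : 0 < kappa by rewrite mulr_gt0//; lra.
(* For beta in ]b, b + eta[ one has beta^2 - b^2 <= eta (2b + 1), since
   eta <= 1; the second entry makes this less than kappa e / (2 M). *)
pose eta := Num.min 1 (kappa * (e / 2) / (2 * (2 * b + 1) * M)).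
have eta0 : 0 < eta.
  by rewrite lt_min ltr01/= divr_gt0 ?mulr_gt0//; lra.
have [beta [cq bb be]] : exists beta, [/\ c < qmax (zeta beta), b < beta & beta < b + eta].
  have qc : \forall beta \near b^'+, c < qmax (zeta beta) by exact: (cvgr_gt _ ql).
  have qb : \forall beta \near b^'+, beta < b + eta by apply: nbhs_right_lt; lra.
  have qg : \forall beta \near b^'+, b < beta by exact: nbhs_right_gt.
  near b^'+ => beta; exists beta; split; near: beta => //.
have beta0 : 0 <= beta by lra.
have [adm zmin] := Hzeta beta beta0.
have [w [u [m [m0 /andP[cu u1] mw wP]]]] :=
  displacement_inequality gamma beta M c (zeta beta) mG GM adm zmin
    ltac:(by rewrite (ltW c0) cq).
rewrite -/G => wle.
have wm s : 0 <= w s <= m by have [] := wP s.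
have u0 : 0 <= u by lra.
have [_ IM] := weighted_integral_le G w u m M mG GM mw wm ltac:(by rewrite u0 ltW).
have exc : b ^+ 2 * \int[mu]_(s in `[0, u]) (G s * w s) + kappa * m * (e - e / 2) <=
    \int[mu]_(s in `[0, u]) (w s * (s / (1 - s))).
  apply: (weighted_excess G w (b ^+ 2) u m M kappa) => //; [lra|lra|lra|exact: ltW| |].
    move=> s /andP[s0 su]; have [->|sn0] := eqVneq s 0.
      by rewrite /G (dxi0 gamma Hxi) mulr0 mul0r.
    by apply: sub; rewrite lt0r sn0 s0/=; lra.
  move=> s /andP[es se]; split.
    by have [_] := wP s; apply; lra.
  have s0 : 0 < s by lra.
  have Gs : G s < r * s.
    by apply: He0 => //=; rewrite sub0r normrN gtr0_norm//; lra.
  have h1 : b ^+ 2 * G s <= b ^+ 2 * r * s by rewrite -mulrA ler_wpM2l// ltW.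
  have h2 : kappa <= (1 - b ^+ 2 * r) * s by rewrite /kappa ler_wpM2l//; lra.
  have h3 : s <= s / (1 - s) by rewrite ler_pdivlMr; nra.
  lra.
move: (\int[mu]_(s in `[0, u]) (G s * w s)) IM exc wle => I IM exc wle.
move: exc => /le_trans /(_ wle).
have d0 : 0 <= beta ^+ 2 - b ^+ 2 by rewrite subr_ge0 lerXn2r ?nnegrE// ltW.
have dle : beta ^+ 2 - b ^+ 2 <= eta * (2 * b + 1).
  have eta1 : eta <= 1 by rewrite ge_min lexx.
  by rewrite subr_sqr; apply: ler_pM; lra.
have etaM : eta * (2 * b + 1) * M < kappa * (e / 2).
  have : eta * (2 * (2 * b + 1) * M) <= kappa * (e / 2).
    rewrite -ler_pdivlMr; last by rewrite !mulr_gt0//; lra.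
    by rewrite ge_min lexx orbT.
  have : 0 < eta * (2 * b + 1) * M by rewrite !mulr_gt0//; lra.
  by lra.
have h : (beta ^+ 2 - b ^+ 2) * I < kappa * (e / 2) * m.
  apply: (le_lt_trans (ler_wpM2l d0 IM)).
  rewrite mulrA ltr_pM2r//; apply: le_lt_trans etaM.
  by rewrite ler_wpM2r// ltW.
have -> : e - e / 2 = e / 2 by lra.
by lra.
Unshelve. all: by end_near.
Qed.

Theorem proposition5p1 (R : realType) (gamma : nat -> R)
  (Hxi : mixture_hyp gamma)
  (d : measure_display) (Omega : measurableType d) (P : probability Omega R)
  (g : seq nat -> {RV P >-> R}) (Hg : is_disorder g)
  (mu0 : forall N : nat, probability (N.-tuple R) R)
  (Hmu0 : forall N : nat, uniform_on_sphere (mu0 N))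
  (zeta : R -> probability R R)
  (Hzeta : forall beta : R, 0 <= beta ->
     is_parisi_measure gamma (free_energy gamma g mu0 beta) beta (zeta beta))
  (Hdisc : discontinuous_RSB (beta_c gamma g mu0) zeta)
  (Hcont : (beta_c gamma g mu0 < beta_cont gamma)%E) :
  exists q : R, 0 < q < 1 /\
    ((q / (1 - q))%:E < beta_c gamma g mu0 ^+ 2 * (derive1 (xi gamma) q)%:E)%E.
Proof.
have [b [l [bcE l0 ql]]] := Hdisc.
(* Otherwise no nonnegative inverse temperature enters the supremum defining
   beta_c, which would then be -oo instead of b. *)
have b0 : 0 <= b.
  rewrite leNgt; apply/negP => blt0.
  suff : (beta_c gamma g mu0 <= -oo)%E by rewrite bcE leeNy_eq.
  apply: ge_ereal_sup => _ [r [r0 rf] <-].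
  have : (r%:E <= b%:E)%E.
    by rewrite -bcE; apply: ereal_sup_ubound; exists r.
  by move=> /(le_trans _) rb; have := rb 0%E; rewrite !lee_fin r0 leNgt blt0 => /(_ isT).
have bG : b ^+ 2 * derive1 (derive1 (xi gamma)) 0 < 1.
  by apply: beta_lt_cont => //; rewrite -bcE.
have [|q [q01 qG]] := discontinuity_point gamma zeta b l Hxi _ b0 l0 ql bG.
  by move=> beta beta0; have [] := Hzeta beta beta0.
by exists q; split => //; rewrite bcE -EFin_expe -EFinM lte_fin.
Qed.
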